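(* Let $\{f_\theta:\theta\in\Theta\}$ be a statistical model for data $x\in\mathcal X$, let $\Pi$ be a proper prior (a probability measure) on $\Theta$, and let $\psi=\Psi(\theta)$ be a parameter of interest, where $\Psi$ maps $\Theta$ onto a set also denoted $\Psi$. Let $RB_\Psi(\psi\,|\,x)$ be the relative belief ratio of $\psi$ at $x$, let $$Pl_\Psi(x)=\{\psi\in\Psi: RB_\Psi(\psi\,|\,x)>1\}$$ be the plausible region for $\psi$, let $M$ be the prior predictive distribution of the data, let $\Pi_\Psi$ be the marginal prior of $\psi$, and let $$F=\{x\in\mathcal X: RB_\Psi(\psi\,|\,x)=1 \text{ for } \Pi_\Psi\text{-almost every } \psi\}.$$ Then: (i) $Pl_\Psi(x)=\Psi$ never holds, i.e. there is no $x$ (at which the posterior is defined) with $Pl_\Psi(x)=\Psi$; (ii) if $M(F)=0$, then $Pl_\Psi(x)=\emptyset$ occurs with prior probability $0$, i.e. the set $\{x: Pl_\Psi(x)=\emptyset\}$ is an $M$-null set.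
   Context: Each $f_\theta$ is a probability density on $\mathcal X$ with respect to a fixed $\sigma$-finite support measure $\mu$, with $(\theta,x)\mapsto f_\theta(x)$ jointly measurable. The map from $\Theta$ onto its range is measurable, and the same symbol $\Psi$ is used for the map and for its range. The marginal prior $\Pi_\Psi$ is the push-forward of $\Pi$ under the map $\Psi$, and $\Pi(\cdot\,|\,\psi)$ denotes the conditional prior of $\theta$ given $\Psi(\theta)=\psi$ (a regular conditional probability, so $\Pi=\int_\Psi \Pi(\cdot\,|\,\psi)\,\Pi_\Psi(d\psi)$). The prior predictive density is $m(x)=\int_\Theta f_\theta(x)\,\Pi(d\theta)$. The prior predictive distribution $M$ is the probability measure on $\mathcal X$ with density $m$ with respect to $\mu$; ''prior probability'' of a set of data values means its $M$-probability. The conditional prior predictive density given $\psi$ is $m(x\,|\,\psi)=\int_\Theta f_\theta(x)\,\Pi(d\theta\,|\,\psi)$, so that $m(x)=\int_\Psi m(x\,|\,\psi)\,\Pi_\Psi(d\psi)$. The posterior is defined at those $x$ with $0<m(x)<\infty$ (a set of $M$-probability 1), and all statements about the posterior, $RB_\Psi(\cdot\,|\,x)$ and $Pl_\Psi(x)$ refer to such $x$. The posterior of $\theta$ is $\Pi(d\theta\,|\,x)=f_\theta(x)\,\Pi(d\theta)/m(x)$, and $\Pi_\Psi(\cdot\,|\,x)$ is the induced marginal posterior of $\psi$. With $\pi_\Psi$ and $\pi_\Psi(\cdot\,|\,x)$ the prior and posterior densities of $\psi$ with respect to a common support measure on $\Psi$, the relative belief ratio is $$RB_\Psi(\psi\,|\,x)=\frac{\pi_\Psi(\psi\,|\,x)}{\pi_\Psi(\psi)}=\frac{m(x\,|\,\psi)}{m(x)},$$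 where the last equality is the Savage–Dickey ratio identity. The version $m(x\,|\,\psi)/m(x)$ defines $RB_\Psi(\psi\,|\,x)$ for every $\psi\in\Psi$. For each such $x$, $RB_\Psi(\cdot\,|\,x)$ is the density of $\Pi_\Psi(\cdot\,|\,x)$ with respect to $\Pi_\Psi$. *)

(* Defs.v *)
From HB Require Import structures.
From mathcomp Require Import all_boot all_order all_algebra.
From mathcomp Require Import all_classical all_reals all_analysis.
From mathcomp Require Import measurable_realfun.

Set Implicit Arguments.
Unset Strict Implicit.
Unset Printing Implicit Defensive.

Import Order.TTheory GRing.Theory Num.Theory.
Import numFieldNormedType.Exports.

Local Open Scope classical_set_scope.
Local Open Scope ring_scope.
Local Open Scope ereal_scope.

Record stat_model (R : realType) (dT dX : measure_display)
    (Theta : measurableType dT) (X : measurableType dX)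
    (mu : {sigma_finite_measure set X -> \bar R}) := StatModel {
  likelihood :> Theta -> X -> R ;
  likelihood_ge0 : forall theta x, (0 <= likelihood theta x)%R ;
  measurable_likelihood :
    measurable_fun [set: Theta * X] (fun tx => likelihood tx.1 tx.2) ;
  likelihood_int1 : forall theta, \int[mu]_x (likelihood theta x)%:E = 1 }.

Arguments stat_model {R dT dX} Theta {X} mu.

Section relative_belief.
Context (R : realType) (dT dX dY : measure_display).
Context (Theta : measurableType dT) (X : measurableType dX).
Context (Y : measurableType dY).
Context (mu : {sigma_finite_measure set X -> \bar R}).
Variable f : stat_model Theta mu.

(* For [P] the prior this is m(x); for [P] the conditional prior given psi it
   is m(x | psi). It may take the value +oo. *)
Definition predictive_density (P : {measure set Theta -> \bar R}) (x : X)
    : \bar R :=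
  \int[P]_theta (f theta x)%:E.

Definition prior_predictive (Pi : probability Theta R) (A : set X) : \bar R :=
  \int[mu]_(x in A) predictive_density Pi x.

(* [K psi] is the conditional prior of theta given Psi(theta) = psi. *)
Definition regular_conditional_prior (Pi : probability Theta R)
    (Psi : {mfun Theta >-> Y}) (K : R.-pker Y ~> Theta) : Prop :=
  forall (A : set Theta) (B : set Y), measurable A -> measurable B ->
    Pi (A `&` Psi @^-1` B) = \int[distribution Pi Psi]_(psi in B) K psi A.

Definition posterior_defined (Pi : probability Theta R) (x : X) : Prop :=
  0 < predictive_density Pi x < +oo.

(* m(x | psi) / m(x), the everywhere-defined version of the density of the
   posterior of psi with respect to its prior. It is meaningful only when
   [posterior_defined Pi x]; the value is +oo when m(x | psi) = +oo. *)
Definition relative_belief (Pi : probability Theta R)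
    (K : R.-pker Y ~> Theta) (psi : Y) (x : X) : \bar R :=
  predictive_density (K psi) x / predictive_density Pi x.

Definition plausible_region (Pi : probability Theta R)
    (K : R.-pker Y ~> Theta) (x : X) : set Y :=
  [set psi | 1 < relative_belief Pi K psi x].

Definition uninformative_data (Pi : probability Theta R)
    (Psi : {mfun Theta >-> Y}) (K : R.-pker Y ~> Theta) : set X :=
  [set x | posterior_defined Pi x /\
    {ae distribution Pi Psi, forall psi, relative_belief Pi K psi x = 1}].

Section prior_predictive_probability.
Variable Pi : probability Theta R.

Let measurable_EFin_likelihood :
  measurable_fun [set: Theta * X] (fun tx => (f tx.1 tx.2)%:E).
Proof. by apply: measurableT_comp => //; exact: measurable_likelihood. Qed.

Let EFin_likelihood_ge0 (tx : (Theta * X)%type) : 0 <= (f tx.1 tx.2)%:E.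
Proof. by rewrite lee_fin likelihood_ge0. Qed.

Lemma predictive_density_ge0 (P : {measure set Theta -> \bar R}) x :
  0 <= predictive_density P x.
Proof. by apply: integral_ge0 => theta _; rewrite lee_fin likelihood_ge0. Qed.

Lemma measurable_predictive_density :
  measurable_fun [set: X] (predictive_density Pi).
Proof.
exact: (@measurable_fun_fubini_tonelli_G _ _ _ _ _ Pi _
  measurable_EFin_likelihood EFin_likelihood_ge0).
Qed.

Let prior_predictive0 : prior_predictive Pi set0 = 0.
Proof. exact: integral_set0. Qed.

Let prior_predictive_ge0 A : 0 <= prior_predictive Pi A.
Proof. by apply: integral_ge0 => x _; exact: predictive_density_ge0. Qed.

Let prior_predictive_sigma_additive :
  semi_sigma_additive (prior_predictive Pi).
Proof.
move=> F mF tF mUF; rewrite /prior_predictive ge0_integral_bigcup//=.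
- apply: is_cvg_ereal_nneg_natsum_cond => n _ _.
  exact: prior_predictive_ge0.
- exact: measurable_funTS measurable_predictive_density.
- by move=> x _; exact: predictive_density_ge0.
Qed.

HB.instance Definition _ := isMeasure.Build _ _ _ (prior_predictive Pi)
  prior_predictive0 prior_predictive_ge0 prior_predictive_sigma_additive.

Let prior_predictive_setT : prior_predictive Pi [set: X] = 1.
Proof.
have := @fubini_tonelli _ _ _ _ _ Pi mu _ measurable_EFin_likelihood
  EFin_likelihood_ge0.
rewrite /= -/(prior_predictive Pi [set: X]) => <-.
under eq_integral do rewrite likelihood_int1.
rewrite integral_cst// mul1e; exact: probability_setT.
Qed.

HB.instance Definition _ := Measure_isProbability.Build _ _ _
  (prior_predictive Pi) prior_predictive_setT.

End prior_predictive_probability.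
End relative_belief.

(* Main.v *)
Require Import Defs.
From HB Require Import structures.
From mathcomp Require Import all_boot all_order all_algebra.
From mathcomp Require Import all_classical all_reals all_analysis.
From mathcomp Require Import measurable_realfun giry.

(** Why the theorem holds. At a data value [x] where 0 < m(x) < +oo, the
    relative belief ratio of [psi] compares m(x | psi) with m(x): it exceeds 1
    iff m(x | psi) > m(x), and it equals 1 iff m(x | psi) = m(x)
    ([relative_belief_gt1], [relative_belief_eq1]). Since the prior is the
    mixture of the conditional priors, m(x) is the average of m(x | psi) over
    the marginal prior of [psi] ([integral_conditional_predictive]). A function
    that stays on one side of its finite average is almost surely equal to it
    ([comparable_predictive_ae_eq], from [le_eq_integral_ae_eq]).

    If every [psi] were plausible, m(x | psi) would exceed its average m(x)
    everywhere while being equal to it almost surely, which a probability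
    measure does not allow. If no [psi] is plausible, m(x | psi) never exceeds
    m(x), so it is almost surely equal to m(x): the data value lies in the
    uninformative set F. This F is measurable ([measurable_uninformative_data]),
    so M(F) = 0 makes every subset of F negligible. *)

Import Order.TTheory GRing.Theory Num.Theory.

Local Open Scope classical_set_scope.
Local Open Scope ring_scope.
Local Open Scope ereal_scope.

(** A subprobability kernel is a measurable map into the Giry monad, and a
    measure that agrees with the bind of [P] and [K] on measurable sets
    integrates as that bind does. *)
Section mixture.
Context (R : realType) (dY dT : measure_display).
Context (Y : measurableType dY) (T : measurableType dT).
Variables (P : probability Y R) (K : R.-spker Y ~> T).

(** A constant of its own, to carry the subprobability structure of each
    fibre [K y]. *)
Let Kset (y : Y) : set T -> \bar R := K y.

HB.instance Definition _ y := Measure.on (Kset y).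

HB.instance Definition _ y := Measure_isSubProbability.Build _ _ _
  (Kset y) (sprob_kernel_le1 K y).

Lemma ge0_integral_mixture (m : {measure set T -> \bar R}) (g : T -> \bar R) :
  (forall A, measurable A -> m A = \int[P]_y K y A) ->
  measurable_fun [set: T] g -> (forall t, 0 <= g t) ->
  \int[m]_t g t = \int[P]_y \int[K y]_t g t.
Proof.
move=> mE mg g0.
pose k : Y -> giry T R := Kset.
have mk : measurable_fun [set: Y] k.
  by apply: measurable_giry_codensity => // B mB; exact: measurable_kernel.
have := @giry_int_bind _ _ _ _ R P k mk g mg g0.
rewrite /giry_int => <-.
apply: eq_measure_integral => A mA _.
rewrite mE //= [RHS]giry_int_map//.
exact: measurable_giry_ev.
Qed.

End mixture.

(** Letting the integrand depend on a parameter [x] amounts to integrating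
    against the kernel on [X * Y] that ignores its first coordinate. *)
Section measurable_integral_kernel_param.
Context (R : realType) (dX dY dT : measure_display).
Context (X : measurableType dX) (Y : measurableType dY).
Context (T : measurableType dT) (K : R.-pker Y ~> T).

Let Kext (xy : X * Y) : {measure set T -> \bar R} := K xy.2.

Let measurable_Kext U : measurable U -> measurable_fun [set: X * Y] (Kext ^~ U).
Proof.
by move=> mU; exact: measurableT_comp (measurable_kernel K U mU) measurable_snd.
Qed.

HB.instance Definition _ := isKernel.Build _ _ _ _ R Kext measurable_Kext.

Let Kext_prob xy : Kext xy [set: T] = 1.
Proof. exact: prob_kernel. Qed.

HB.instance Definition _ := Kernel_isProbability.Build _ _ _ _ R Kext Kext_prob.

Lemma measurable_integral_kernel_param (g : X * T -> \bar R) :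
  measurable_fun [set: X * T] g -> (forall xt, 0 <= g xt) ->
  measurable_fun [set: X * Y] (fun xy => \int[K xy.2]_t g (xy.1, t)).
Proof.
move=> mg g0.
apply: (@measurable_fun_integral_finite_kernel _ _ _ _ _
  (fun z : (X * Y) * T => g (z.1.1, z.2)) Kext) => //.
apply: measurableT_comp mg _; apply: measurable_fun_pair => //.
exact: measurableT_comp measurable_fst measurable_fst.
Qed.

End measurable_integral_kernel_param.

(** Integrability makes [g] finite almost everywhere; there [g - f] is
    well defined and nonnegative, and its zero integral forces it to vanish
    almost everywhere. *)
Lemma le_eq_integral_ae_eq {R : realType} {d : measure_display}
    {T : measurableType d} {mu : {measure set T -> \bar R}}
    {f g : T -> \bar R} :
  mu.-integrable [set: T] f -> mu.-integrable [set: T] g ->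
  (forall t, f t <= g t) -> \int[mu]_t f t = \int[mu]_t g t ->
  {ae mu, forall t, f t = g t}.
Proof.
move=> fi gi fg fgE.
have mgf : measurable_fun [set: T] (g \- f).
  by apply: emeasurable_funB; exact: (measurable_int mu).
have gfin := integrable_ae measurableT gi.
have gf0 : ae_eq mu [set: T] (g \- f) (cst 0).
  apply/ae_eq_integral_abs => //.
  rewrite -(@subee _ (\int[mu]_t f t)) ?integrable_fin_num//.
  rewrite [X in _ = X - _]fgE -integralB//; apply: ae_eq_integral => //.
  - exact: measurableT_comp.
  - move: gfin; apply: filterS => t /(_ I) gt _ /=.
    by rewrite gee0_abs// sube_ge0 ?gt ?orbT.
move: gf0 gfin; apply: filterS2 => t /(_ I) /= /eqP gft /(_ I) gt.
by move: gft; rewrite sube_eq ?fin_num_adde_defr// add0e => /eqP.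
Qed.

Section relative_belief_theory.
Set Implicit Arguments.
Unset Strict Implicit.
Context (R : realType) (dT dX dY : measure_display)
  (Theta : measurableType dT) (X : measurableType dX) (Y : measurableType dY)
  (mu : {sigma_finite_measure set X -> \bar R}) (f : stat_model Theta mu)
  (Pi : probability Theta R) (K : R.-pker Y ~> Theta).

(** Dividing by m(x) is an order isomorphism because 0 < m(x) < +oo, so the
    comparison of the relative belief ratio with 1 is the comparison of
    m(x | psi) with m(x); this stays true when m(x | psi) = +oo. *)
Lemma relative_belief_eq1 x psi : posterior_defined f Pi x ->
  relative_belief f Pi K psi x = 1 <->
  predictive_density f (K psi) x = predictive_density f Pi x.
Proof.
move=> /andP[m0 moo]; rewrite /relative_belief.
have mfin : predictive_density f Pi x \is a fin_num by rewrite ge0_fin_numE ?ltW.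
move: m0; rewrite -(fineK mfin) lte_fin => m0.
rewrite inver (gt_eqF m0); split => [/eqP|->].
  by rewrite muleC eqe_pdivrMl ?lt0r_neq0// mule1 => /eqP.
by rewrite -EFinM divff// lt0r_neq0.
Qed.

Lemma relative_belief_gt1 x psi : posterior_defined f Pi x ->
  (1 < relative_belief f Pi K psi x) =
  (predictive_density f Pi x < predictive_density f (K psi) x).
Proof.
move=> /andP[m0 moo]; rewrite /relative_belief.
have mfin : predictive_density f Pi x \is a fin_num by rewrite ge0_fin_numE ?ltW.
move: m0; rewrite -(fineK mfin) lte_fin => m0.
by rewrite inver (gt_eqF m0) lte_pdivlMr// mul1e.
Qed.

Lemma measurable_EFin_likelihood x :
  measurable_fun [set: Theta] (fun theta => (f theta x)%:E).
Proof.
apply/measurable_EFinP.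
exact: measurableT_comp (measurable_likelihood f) (pair2_measurable x).
Qed.

(** Joint measurability in the data and the parameter of interest: measurability
    of every section would not be enough to apply Fubini to the set where
    m(x | psi) and m(x) differ. *)
Lemma measurable_predictive_density_kernel :
  measurable_fun [set: X * Y]
    (fun xy => predictive_density f (K xy.2) xy.1).
Proof.
apply: (@measurable_integral_kernel_param _ _ _ _ _ _ _ K
  (fun xt => (f xt.2 xt.1)%:E)) => [|xt]; last by rewrite lee_fin likelihood_ge0.
apply/measurable_EFinP.
have := measurableT_comp (measurable_likelihood f)
  (@measurable_swap _ _ X Theta).
by [].
Qed.

Lemma measurable_predictive_density_condl x :
  measurable_fun [set: Y] (fun psi => predictive_density f (K psi) x).
Proof.
have := measurableT_comp measurable_predictive_density_kernel
  (pair1_measurable x).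
by [].
Qed.

Variable Psi : {mfun Theta >-> Y}.
Hypothesis K_cond : regular_conditional_prior Pi Psi K.

(** The identity that makes m(x) an average of the m(x | psi): the prior is the
    mixture of the conditional priors. *)
Lemma integral_conditional_predictive x :
  \int[distribution Pi Psi]_psi predictive_density f (K psi) x =
  predictive_density f Pi x.
Proof.
apply/esym/ge0_integral_mixture.
- by move=> A mA; rewrite -(K_cond mA measurableT) // preimage_setT setIT.
- exact: measurable_EFin_likelihood.
- by move=> theta; rewrite lee_fin likelihood_ge0.
Qed.

(** A finite average can be an upper or a lower bound of what it averages only
    when there is almost surely no variation. The first alternative is what an
    empty plausible region gives, the second what a full one gives. *)
Lemma comparable_predictive_ae_eq x : posterior_defined f Pi x ->
  (forall psi, predictive_density f (K psi) x <= predictive_density f Pi x) \/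
  (forall psi, predictive_density f Pi x <= predictive_density f (K psi) x) ->
  {ae distribution Pi Psi, forall psi,
    predictive_density f (K psi) x = predictive_density f Pi x}.
Proof.
move=> /andP[m0 moo].
pose P : probability Y R := distribution Pi Psi.
have Icond : P.-integrable [set: Y] (fun psi => predictive_density f (K psi) x).
  apply/integrableP; split; first exact: measurable_predictive_density_condl.
  under eq_integral do rewrite gee0_abs ?predictive_density_ge0//.
  by rewrite integral_conditional_predictive.
have Icst : P.-integrable [set: Y] (cst (predictive_density f Pi x)).
  apply/integrableP; split => //.
  rewrite (eq_integral (cst (predictive_density f Pi x))) => [|psi _].
    by rewrite integral_cst// [X in _ * X](probability_setT P) mule1.
  by rewrite gee0_abs// ltW.
have IE : \int[P]_psi predictive_density f (K psi) x =
    \int[P]_psi cst (predictive_density f Pi x) psi.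
  rewrite integral_conditional_predictive integral_cst//.
  by rewrite [X in _ * X](probability_setT P) mule1.
case=> le; first exact: le_eq_integral_ae_eq.
have := le_eq_integral_ae_eq Icst Icond le (esym IE).
by apply: filterS => psi.
Qed.

(** Among the data values with 0 < m(x) < +oo, the set is cut out by the
    condition that the [x]-section of [N = {(x, psi) | m(x | psi) != m(x)}] has
    prior measure zero, and the measure of a section of a measurable set is
    measurable in [x]. Measurability is what lets a vanishing integral of m,
    which is how the prior predictive probability is defined, yield a
    negligible set. *)
Lemma measurable_uninformative_data :
  measurable (uninformative_data f Pi Psi K).
Proof.
pose P := distribution Pi Psi.
pose N := [set xy : X * Y | predictive_density f (K xy.2) xy.1 !=
                            predictive_density f Pi xy.1].
have mpd : measurable_fun [set: X] (predictive_density f Pi).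
  exact: measurable_predictive_density.
have mN : measurable N.
  rewrite -[N]setTI; apply: measurable_neqe => //.
    exact: measurable_predictive_density_kernel.
  exact: measurableT_comp mpd measurable_fst.
suff -> : uninformative_data f Pi Psi K =
    ([set x | 0 < predictive_density f Pi x] `&`
     [set x | predictive_density f Pi x < +oo]) `&`
    [set x | P (xsection N x) = 0].
  apply: measurableI.
    apply: measurableI; rewrite -[X in measurable X]setTI;
      exact: measurable_lte.
  rewrite -[X in measurable X]setTI; apply: measurable_eqe => //.
  exact: measurable_fun_xsection.
apply/seteqP; split=> x.
  move=> [xdef aeq]; split; first by move/andP: (xdef).
  apply/negligibleP; first exact: measurable_xsection.
  apply: negligibleS aeq => psi; rewrite /xsection/= inE => /eqP.
  by apply: contra_not => /relative_belief_eq1; exact.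
move=> [[m0 moo] /negligibleP Nneg].
have xdef : posterior_defined f Pi x by apply/andP.
split => //; apply: negligibleS (Nneg (measurable_xsection _ mN)).
move=> psi /= ne; rewrite /xsection/= inE; apply/eqP.
by move: ne; apply: contra_not => eq; exact/relative_belief_eq1.
Qed.

End relative_belief_theory.

Theorem theorem1 (R : realType) (dT dX dY : measure_display)
    (Theta : measurableType dT) (X : measurableType dX) (Y : measurableType dY)
    (mu : {sigma_finite_measure set X -> \bar R}) (f : stat_model Theta mu)
    (Pi : probability Theta R) (Psi : {mfun Theta >-> Y})
    (K : R.-pker Y ~> Theta)
    (Psi_onto : range Psi = [set: Y])
    (K_cond : regular_conditional_prior Pi Psi K) :
  (forall x : X, posterior_defined f Pi x ->
     plausible_region f Pi K x <> [set: Y]) /\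
  (prior_predictive f Pi (uninformative_data f Pi Psi K) = 0 ->
   (prior_predictive f Pi).-negligible
     [set x | posterior_defined f Pi x /\ plausible_region f Pi K x = set0]).
Proof.
split=> [x xdef Pl_all|MF0].
  have gt1 psi : predictive_density f Pi x < predictive_density f (K psi) x.
    have : plausible_region f Pi K x psi by rewrite Pl_all.
    by rewrite /plausible_region/= relative_belief_gt1.
  have aeq := comparable_predictive_ae_eq K_cond xdef
    (or_intror (fun psi => ltW (gt1 psi))).
  have : distribution Pi Psi [set: Y] = 0.
    apply/negligibleP => //; apply: negligibleS aeq => psi _ /= eq.
    by move: (gt1 psi); rewrite eq ltxx.
  by rewrite probability_setT => /eqP; rewrite onee_eq0.
apply: (@negligibleS _ _ _ _ (uninformative_data f Pi Psi K)); last first.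
  by apply/negligibleP => //; exact: measurable_uninformative_data.
move=> x [xdef Pl0]; split => //.
have le1 psi : predictive_density f (K psi) x <= predictive_density f Pi x.
  rewrite leNgt; apply/negP; rewrite -relative_belief_gt1// => gt1.
  by have : plausible_region f Pi K x psi by []; rewrite Pl0.
have := comparable_predictive_ae_eq K_cond xdef (or_introl le1).
by apply: filterS => psi /relative_belief_eq1; exact.
Qed.
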